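(* Let $p>3$ be a prime. For $c,d\in\mathbb{Z}$ put $$D_p(c,d):=\det[(i^2+cij+dj^2)^{p-2}]_{1\le i,j\le p-1}.$$ (i) If $p\equiv 3\pmod 4$, then $D_p(c,-1)\equiv 0\pmod p$ for all $c\in\mathbb{Z}$. (ii) If $p\equiv 3\pmod 4$, then $D_p(2,2)\equiv 0\pmod p$. If $p\equiv\pm1\pmod{12}$, then $D_p(6,6)\equiv 0\pmod p$.
   Context: $[a_{ij}]_{1\le i,j\le p-1}$ denotes the $(p-1)\times(p-1)$ integer matrix with rows and columns indexed by $1,\ldots,p-1$ whose $(i,j)$ entry is $a_{ij}$. *)

(* Defs.v *)
From mathcomp Require Import all_boot all_order all_algebra.

Set Implicit Arguments.
Unset Strict Implicit.
Unset Printing Implicit Defensive.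

Import GRing.Theory.
Local Open Scope ring_scope.

(* Ordinals of 'I_p.-1 start at 0, whereas the rows and columns are indexed
   by 1, ..., p - 1; hence the shift by one. *)
Definition Dmx (p : nat) (c d : int) : 'M[int]_(p.-1) :=
  \matrix_(i < p.-1, j < p.-1)
    (let x : int := (i.+1)%:Z in let y : int := (j.+1)%:Z in
     (x ^+ 2 + c * x * y + d * y ^+ 2) ^+ (p - 2)%N).

Definition Dp (p : nat) (c d : int) : int := \det (Dmx p c d).

(* Main.v *)
(* Over 'F_p, u^(p-2) is u^-1 with the convention 0^-1 = 0, so D_p(c,d) is up to
   a unit the group determinant of t |-> (t^2 + c t + d)^-1 on the cyclic group
   'F_p^*, and it vanishes as soon as one sum
   S_k = sum_x x^k (x^2 + c x + d)^-1 does. For d = -1 one takes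
   k = (p + 1) / 2 and uses the substitution x |-> -1 / x; for (2,2) and (6,6)
   one takes k = 2 and completes the square, which leaves constants, odd
   functions and, for (6,6), the difference of two translates of 1 / y
   (as 3 is a square modulo p). *)
Require Import Defs.
From mathcomp Require Import all_boot all_order all_algebra.
From mathcomp Require Import cyclic finfield ring zify.

Set Implicit Arguments.
Unset Strict Implicit.
Unset Printing Implicit Defensive.

Import GRing.Theory.
Local Open Scope ring_scope.

Lemma sum_odd_eq0 (F : finFieldType) (h f : F -> F) :
  (2 != 0 :> F) -> injective h -> (forall x, f (h x) = - f x) ->
  \sum_x f x = 0.
Proof.
move=> two_neq0 h_inj f_odd; set S := \sum_x f x.
have SN : S = - S by rewrite {1}/S (reindex_inj h_inj) -sumrN; apply: eq_bigr.
have /eqP : 2 * S = 0 by rewrite -[2]/(1 + 1) mulrDl mul1r {2}SN subrr.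
by rewrite mulf_eq0 (negPf two_neq0) => /eqP.
Qed.

Lemma sum_Fp (p : nat) (f : 'F_p -> 'F_p) :
  prime p -> \sum_x f x = f 0 + \sum_(i < p.-1) f (i.+1)%:R.
Proof.
move=> p_pr.
(* ['F_p] is an ordinal type whose bound equals [p] only propositionally, so the bound is
   generalised to [n.+1]. *)
have cast n : n.+1 = p ->
    \sum_(i < n.+1) f i%:R = f 0 + \sum_(i < p.-1) f (i.+1)%:R.
  move=> np; have <- : n = p.-1 by lia.
  by rewrite big_ord_recl.
rewrite -(cast _ (Fp_cast p_pr)); apply: eq_bigr => x _.
by rewrite natr_Zp.
Qed.

Lemma natr_Fp_neq0 (p n : nat) :
  prime p -> (0 < n < p)%N -> n%:R != 0 :> 'F_p.
Proof.
move=> p_pr /andP[n_gt0 n_lt].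
by rewrite -(dvdn_pcharf (pchar_Fp p_pr)) gtnNdvd.
Qed.

Lemma expf_p1 (p : nat) (x : 'F_p) : prime p -> x != 0 -> x ^+ p.-1 = 1.
Proof.
move=> p_pr x0; apply: (mulfI x0); rewrite -exprS prednK ?prime_gt0 //.
by have := expf_card x; rewrite card_Fp // mulr1.
Qed.

Lemma expf_p2 (p : nat) (x : 'F_p) :
  prime p -> (2 < p)%N -> x ^+ (p - 2) = x^-1.
Proof.
move=> p_pr p_gt2; have [->|x0] := eqVneq x 0.
  by rewrite invr0 expr0n; case: eqP => // ?; lia.
apply: (mulfI x0); rewrite -exprS mulfV // (_ : (p - 2).+1 = p.-1); last lia.
exact: expf_p1.
Qed.

(* Modulo [p] the matrix has entries [j^-2 * f (i / j)], with
   [f t = (t^2 + c t + d)^-1], so it sends the row vector [i |-> i^k] to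
   [j |-> j^(k - 2)] times the sum of the hypothesis. *)
Lemma Dp_eq0 (p k : nat) (c d : int) :
  prime p -> (2 < p)%N -> (0 < k)%N ->
  \sum_(x : 'F_p) x ^+ k * (x ^+ 2 + c%:~R * x + d%:~R)^-1 = 0 ->
  (Dp p c d = 0 %[mod p%:Z])%Z.
Proof.
move=> p_pr p_gt2 k_gt0 S0; apply/eqP.
rewrite eqz_mod_dvd subr0 (dvdz_pcharf (pchar_Fp p_pr)) /Dp -det_map_mx.
have nz (i : 'I_p.-1) : (i.+1)%:R != 0 :> 'F_p.
  by apply: natr_Fp_neq0 => //; have := ltn_ord i; lia.
apply/det0P; exists (\row_i (i.+1)%:R ^+ k).
  have p1 : (0 < p.-1)%N by lia.
  apply/eqP => /rowP /(_ (Ordinal p1)); rewrite !mxE => /eqP.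
  by rewrite expf_eq0 (negPf (nz _)) andbF.
apply/rowP => j; rewrite !mxE; set y : 'F_p := (j.+1)%:R.
have y0 : y != 0 := nz j.
pose g (x : 'F_p) := x ^+ k * (x ^+ 2 + c%:~R * x * y + d%:~R * y ^+ 2)^-1.
transitivity (\sum_x g x).
  (* The term at 0 vanishes since [k > 0], so the entry extends to a sum over all of ['F_p]. *)
  rewrite sum_Fp // {1}/g expr0n eqn0Ngt k_gt0 mul0r add0r.
  apply: eq_bigr => i _; rewrite !mxE /g -expf_p2 //.
  have castE (R : comNzRingType) (a b : nat) n :
      ((a%:Z ^+ 2 + c * a%:Z * b%:Z + d * b%:Z ^+ 2) ^+ n)%:~R =
      (a%:R ^+ 2 + c%:~R * a%:R * b%:R + d%:~R * b%:R ^+ 2) ^+ n :> R.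
    by rewrite rmorphXn !rmorphD /= !(rmorphXn, rmorphM).
  by congr (_ * _); apply: castE.
(* By homogeneity, replacing [x] by [x * y] pulls [y ^+ 2] out of the quadratic form. *)
rewrite (reindex_inj (mulIf y0)) /=.
transitivity (\sum_(x : 'F_p) y ^+ k / y ^+ 2 *
    (x ^+ k * (x ^+ 2 + c%:~R * x + d%:~R)^-1)).
  2: by rewrite -mulr_sumr S0 mulr0.
apply: eq_bigr => x _; rewrite /g exprMn.
have -> : (x * y) ^+ 2 + c%:~R * (x * y) * y + d%:~R * y ^+ 2 =
  y ^+ 2 * (x ^+ 2 + c%:~R * x + d%:~R) by ring.
by rewrite invfM; ring.
Qed.

Lemma sum_1_Fp (p : nat) : prime p -> \sum_(x : 'F_p) (1 : 'F_p) = 0.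
Proof.
by move=> p_pr; rewrite sumr_const card_Fp // pcharf0 // pchar_Fp.
Qed.

(* For [k = (p + 1) / 2], which is even, the summand changes sign under
   [x |-> - 1 / x] because [x^(2 k - 2) = 1]. *)
Lemma char_sum_m1_eq0 (p : nat) (c : 'F_p) :
  prime p -> (p = 3 %[mod 4])%N ->
  \sum_(x : 'F_p) x ^+ (p.+1 %/ 2) * (x ^+ 2 + c * x - 1)^-1 = 0.
Proof.
move=> p_pr p3; pose n := (p %/ 4)%N; have pE : p = (4 * n + 3)%N by lia.
rewrite (_ : (p.+1 %/ 2)%N = n.+1.*2); last lia.
apply: (@sum_odd_eq0 _ (fun x => - x^-1)).
- by apply: natr_Fp_neq0 => //; lia.
- by move=> x y /oppr_inj /invr_inj.
move=> x; have [->|x0] := eqVneq x 0.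
  by rewrite invr0 oppr0 expr0n /= !mul0r oppr0.
have -> : (- x^-1) ^+ 2 + c * (- x^-1) - 1 = - (x ^+ 2 + c * x - 1) / x ^+ 2.
  by field.
have E : (- x^-1) ^+ n.+1.*2 * x ^+ 2 = x ^+ n.+1.*2.
  have xx : x ^+ n.+1.*2 * x ^+ n.+1.*2 = x ^+ 2.
    rewrite -[RHS]mul1r -(expf_p1 p_pr x0) -!exprD; congr (_ ^+ _).
    by lia.
  rewrite exprNn -signr_odd odd_double expr0 mul1r exprVn -xx mulKf //.
  by rewrite expf_neq0.
by rewrite mulNr invrN invfM invrK mulrN [_^-1 * _]mulrC mulrA E.
Qed.

(** If [x ^+ 2 = -1], the oddness of (p - 1) / 2 gives [x ^+ p.-1 = -1], against Fermat's little
    theorem. *)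
Lemma sqrD1_Fp_neq0 (p : nat) (x : 'F_p) :
  prime p -> (p = 3 %[mod 4])%N -> x ^+ 2 + 1 != 0.
Proof.
move=> p_pr p3; apply/eqP => /eqP; rewrite addr_eq0 => /eqP x2.
have x0 : x != 0.
  apply/eqP => x0; move/eqP: x2; rewrite x0 expr0n eq_sym oppr_eq0.
  by rewrite oner_eq0.
have := expf_p1 p_pr x0.
rewrite (_ : p.-1 = (2 * (p %/ 4).*2.+1)%N); last lia.
rewrite exprM x2 -signr_odd /= odd_double /= expr1 => /eqP.
rewrite eq_sym -addr_eq0 -[1 + 1]/(2%:R).
by apply/negP/natr_Fp_neq0 => //; lia.
Qed.

(** With x = y - 1 the summand is 1 - 2y / (y^2 + 1): the constant sums to p = 0 and the rest is
    odd. *)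
Lemma char_sum_22_eq0 (p : nat) :
  prime p -> (p = 3 %[mod 4])%N ->
  \sum_(x : 'F_p) x ^+ 2 * (x ^+ 2 + 2 * x + 2)^-1 = 0.
Proof.
move=> p_pr p3; rewrite (reindex_inj (addIr (-1))) /=.
transitivity (\sum_(y : 'F_p) (1 - 2 * y * (y ^+ 2 + 1)^-1)).
  apply: eq_bigr => y _; have y1 := sqrD1_Fp_neq0 y p_pr p3.
  have -> : (y - 1) ^+ 2 + 2 * (y - 1) + 2 = y ^+ 2 + 1 by ring.
  by field.
rewrite big_split /= sum_1_Fp // add0r; apply: (sum_odd_eq0 _ oppr_inj).
  by apply: natr_Fp_neq0 => //; lia.
by move=> y; rewrite sqrrN; ring.
Qed.

(** With x = y - 3 the summand is 1 - 6y / (y^2 - 3) + 12 / (y^2 - 3) where y^2 is not 3, and s^2 =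
    3 splits the last term as 2s (1 / (y - s) - 1 / (y + s)). *)
Lemma char_sum_66_eq0 (p : nat) (s : 'F_p) :
  prime p -> (3 < p)%N -> s ^+ 2 = 3 ->
  \sum_(x : 'F_p) x ^+ 2 * (x ^+ 2 + 6 * x + 6)^-1 = 0.
Proof.
move=> p_pr p_gt3 s2; rewrite (reindex_inj (addIr (-3))) /=.
have two0 : 2 != 0 :> 'F_p by apply: natr_Fp_neq0 => //; lia.
have s0 : s != 0.
  apply: contraTneq (natr_Fp_neq0 (n := 3) p_pr p_gt3) => s0.
  by rewrite -s2 s0 expr0n eqxx.
have ss0 : s + s != 0 by rewrite -mulr2n -mulr_natl mulf_neq0.
(* The junk value [0^-1 = 0] makes this identity true also at [y = s, - s],
   the points where the left-hand side has a zero denominator. *)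
transitivity (\sum_(y : 'F_p) (1 + - (6 * y * (y ^+ 2 - 3)^-1)
    + 2 * s * ((y - s)^-1 - (y + s)^-1))).
  apply: eq_bigr => y _.
  have -> : (y - 3) ^+ 2 + 6 * (y - 3) + 6 = y ^+ 2 - 3 by ring.
  have [->|ys] := eqVneq y s.
    by rewrite s2 !subrr invr0; field.
  have [->|yNs] := eqVneq y (- s).
    by rewrite sqrrN s2 !addNr subrr invr0; field; rewrite -opprD oppr_eq0.
  have ym : y - s != 0 by rewrite subr_eq0.
  have yp : y + s != 0 by rewrite addr_eq0.
  have -> : y ^+ 2 - 3 = (y - s) * (y + s) by rewrite -s2 subr_sqr.
  apply: (mulIf (mulf_neq0 ym yp)); rewrite mulfVK ?mulf_neq0 //.
  transitivity (y ^+ 2 - s ^+ 2 - 6 * y + 4 * s ^+ 2).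
    by rewrite s2; ring.
  by field; rewrite ym yp.
have sum_inv (a : 'F_p) : \sum_(y : 'F_p) (y + a)^-1 = \sum_(y : 'F_p) y^-1.
  by rewrite [RHS](reindex_inj (addIr a)).
rewrite !big_split /= sum_1_Fp // -mulr_sumr sumrB !sum_inv subrr.
rewrite mulr0 addr0 add0r.
apply: (sum_odd_eq0 two0 oppr_inj) => y.
by rewrite sqrrN; ring.
Qed.

Lemma Fp_prim_root (p n : nat) :
  prime p -> (n %| p.-1)%N -> exists z : 'F_p, n.-primitive_root z.
Proof.
move=> p_pr n_dvd.
have /hasP[g _ g_prim] : has p.-1.-primitive_root (enum (predC1 (0 : 'F_p))).
  apply: has_prim_root (enum_uniq _) _.
  - by have := prime_gt1 p_pr; lia.
  - by apply/allP => x; rewrite mem_enum inE => x0; apply/unity_rootP/expf_p1.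
  - by rewrite -cardE cardC1 card_Fp.
by exists (g ^+ (p.-1 %/ n)); apply: dvdn_prim_root.
Qed.

(** The model is 2 cos(pi / 6) = sqrt 3: with z a primitive 12th root of unity, z + 1 / z is the
    square root. *)
Lemma sqrt3_1mod12 (p : nat) :
  prime p -> (p = 1 %[mod 12])%N -> exists s : 'F_p, s ^+ 2 = 3.
Proof.
move=> p_pr p1; have [|z z_prim] := @Fp_prim_root p 12 p_pr.
  by apply/eqP; lia.
have z0 : z != 0.
  apply/eqP => z0; have /eqP := prim_expr_order z_prim.
  by rewrite z0 expr0n eq_sym oner_eq0.
have z6 : z ^+ 6 != 1 by rewrite -(prim_order_dvd z_prim).
have z4 : z ^+ 4 != 1 by rewrite -(prim_order_dvd z_prim).
(* The twelfth cyclotomic polynomial at [z]; the other factors of [z ^+ 12 - 1] are nonzero by [z6]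
   and [z4]. *)
have Phi : z ^+ 4 - z ^+ 2 + 1 = 0.
  have /eqP : (z ^+ 6 - 1) * ((z ^+ 2 + 1) * (z ^+ 4 - z ^+ 2 + 1)) = 0.
    by transitivity (z ^+ 12 - 1); [ring | rewrite prim_expr_order // subrr].
  rewrite !mulf_eq0 subr_eq0 (negPf z6) /= => /orP[/eqP z2|/eqP //].
  case/eqP: z4; transitivity ((z ^+ 2 + 1) * (z ^+ 2 - 1) + 1); first ring.
  by rewrite z2 mul0r add0r.
exists (z + z^-1); apply/eqP; rewrite -subr_eq0; apply/eqP.
transitivity ((z ^+ 4 - z ^+ 2 + 1) / z ^+ 2); first by field.
by rewrite Phi mul0r.
Qed.

(* [s = 3^((p + 1) / 4)] satisfies [s^2 = 3] or [s^2 = -3]; in the second case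
   [(s - 1) / 2] would be a nontrivial cube root of unity. *)
Lemma sqrt3_11mod12 (p : nat) :
  prime p -> (p = 11 %[mod 12])%N -> exists s : 'F_p, s ^+ 2 = 3.
Proof.
move=> p_pr p11; pose n := (p %/ 12)%N; have pE : p = (12 * n + 11)%N by lia.
have two0 : 2 != 0 :> 'F_p by apply: natr_Fp_neq0 => //; lia.
have three0 : 3 != 0 :> 'F_p by apply: natr_Fp_neq0 => //; lia.
(* [e] is 3^((p - 1) / 2), hence 1 or -1. *)
pose e : 'F_p := 3 ^+ (6 * n + 5); pose s : 'F_p := 3 ^+ (3 * n + 3).
have s2 : s ^+ 2 = 3 * e.
  by rewrite /s /e -exprM -exprS; congr (_ ^+ _); lia.
have : e ^+ 2 == 1.
  apply/eqP; rewrite /e -exprM -[RHS](expf_p1 p_pr three0).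
  by congr (_ ^+ _); lia.
rewrite sqrf_eq1 => /orP[/eqP e1|/eqP e1].
  by exists s; rewrite s2 e1 mulr1.
rewrite e1 mulrN1 in s2.
pose w := (s - 1) / 2.
have w3 : w ^+ 3 = 1.
  have : w ^+ 3 - 1 = (s ^+ 2 + 3) * (s - 3) / 2 ^+ 3.
    by rewrite /w; field; rewrite two0 natr_Fp_neq0 //; lia.
  by rewrite s2 addNr !mul0r => /eqP; rewrite subr_eq0 => /eqP.
have w0 : w != 0.
  by apply/eqP => w0; move/eqP: w3; rewrite w0 expr0n eq_sym oner_eq0.
(* Since p - 1 is 1 modulo 3, Fermat and [w3] force [w = 1]; then s = 3, and s^2 = -3 gives 12 =
   0. *)
have w1 : w = 1.
  have := expf_p1 p_pr w0; rewrite (_ : p.-1 = (3 * (4 * n + 3)).+1); last lia.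
  by rewrite exprS exprM w3 expr1n mulr1.
have s3 : s = 3.
  by transitivity (2 * w + 1); [rewrite /w; field | rewrite w1; ring].
have : 2 * 2 * 3 == 0 :> 'F_p.
  apply/eqP; transitivity (s ^+ 2 + 3); first by rewrite s3; ring.
  by rewrite s2 addNr.
by rewrite !mulf_eq0 (negPf two0) (negPf three0).
Qed.

Theorem theorem1p8 (p : nat) (p_prime : prime p) (p_gt3 : (3 < p)%N) :
  ((p = 3 %[mod 4])%N ->
     forall c : int, (Dp p c (-1) = 0 %[mod p%:Z])%Z) /\
  (((p = 3 %[mod 4])%N -> (Dp p 2 2 = 0 %[mod p%:Z])%Z) /\
   ((p%:Z = 1 %[mod 12])%Z \/ (p%:Z = -1 %[mod 12])%Z ->
     (Dp p 6 6 = 0 %[mod p%:Z])%Z)).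
Proof.
have p_gt2 := ltnW p_gt3.
split=> [p3 c|].
  apply: (@Dp_eq0 _ (p.+1 %/ 2)) => //; first lia.
  by rewrite rmorphN1 char_sum_m1_eq0.
split=> [p3|p12].
  by apply: (@Dp_eq0 _ 2) => //; apply: char_sum_22_eq0.
have [s s2] : exists s : 'F_p, s ^+ 2 = 3.
  by case: p12 => p12; [apply: sqrt3_1mod12 | apply: sqrt3_11mod12] => //; lia.
by apply: (@Dp_eq0 _ 2) => //; apply: char_sum_66_eq0 s2.
Qed.
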